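(* Let $\Gamma$ be a consistent set of quantifier-free (propositional) axioms. Then there is a polarized rewrite system $\mathcal R$ that presents $\Gamma$, such that the relations $\longrightarrow_{-}$ and $\longrightarrow_{+}$ commute and cut elimination holds for $\mathcal R$, i.e. every proof-term of polarized natural deduction modulo $\mathcal R$ is strongly normalizable and every sequent provable in polarized classical sequent calculus modulo $\mathcal R$ has a proof that does not use the cut rule.
   Context: Propositions are built from atomic propositions (propositional symbols) and the constant $\bot$ using the binary connectives $\Rightarrow$, $\wedge$, $\vee$; $\neg A$ abbreviates $A\Rightarrow\bot$. $\Gamma$ is consistent if $\bot$ is not derivable from $\Gamma$ in classical propositional logic. A rewrite rule is a pair $P \longrightarrow A$ with $P$ an atomic proposition and $A$ an arbitrary proposition. A polarized rewrite system $\mathcal R = \langle \mathcal R_{-}, \mathcal R_{+}\rangle$ is a pair of sets of rewrite rules; rules of $\mathcal R_{-}$ are called negative, those of $\mathcal R_{+}$ positive. $\mathcal R$ presents $\Gamma$ if the set $\mathcal T_{\mathcal R}$ consisting of $P\Rightarrow A$ for each negative rule $P\longrightarrow A$ and $A\Rightarrow P$ for each positive rule $P\longrightarrow A$ has the same classical consequences as $\Gamma$. The one-step relations $\longrightarrow^1_{-}$, $\longrightarrow^1_{+}$ are the least relations on propositions such that: $P \longrightarrow^1_{-} A$ for every negative rule $P \longrightarrow A$; $P \longrightarrow^1_{+} A$ for every positive rule $P\longrightarrow A$; $A \Rightarrow B \longrightarrow^1_{-} A' \Rightarrow B$ if $A \longrightarrow^1_{+} A'$, and $A \Rightarrow B \longrightarrow^1_{-}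 A \Rightarrow B'$ if $B \longrightarrow^1_{-} B'$; $A \Rightarrow B \longrightarrow^1_{+} A' \Rightarrow B$ if $A \longrightarrow^1_{-} A'$, and $A \Rightarrow B \longrightarrow^1_{+} A \Rightarrow B'$ if $B \longrightarrow^1_{+} B'$; for $\circ \in \{\wedge, \vee\}$ and $s \in \{-,+\}$, $A \circ B \longrightarrow^1_{s} A' \circ B$ if $A \longrightarrow^1_{s} A'$, and $A \circ B \longrightarrow^1_{s} A \circ B'$ if $B \longrightarrow^1_{s} B'$. The relations $\longrightarrow_{-}$, $\longrightarrow_{+}$ are the reflexive-transitive closures of $\longrightarrow^1_{-}$, $\longrightarrow^1_{+}$; $B \longleftarrow_{s} A$ means $A \longrightarrow_{s} B$. They commute if whenever $A \longleftarrow_{-} B \longrightarrow_{+} C$ there is $D$ with $A \longrightarrow_{+} D \longleftarrow_{-} C$. Natural deduction: proof-terms are $\pi ::= \alpha \mid \lambda\alpha\,\pi \mid (\pi_1\,\pi_2) \mid \langle \pi_1,\pi_2\rangle \mid \mathit{fst}(\pi) \mid \mathit{snd}(\pi) \mid i(\pi) \mid j(\pi) \mid \delta(\pi_1, \alpha\pi_2, \beta\pi_3) \mid \delta_\bot(\pi)$ ($\alpha,\beta$ proof variables; $\lambda\alpha$ binds $\alpha$; in $\delta(\pi_1,\alpha\pi_2,\beta\pi_3)$, $\alpha$ is bound in $\pi_2$, $\beta$ in $\pi_3$). With $\Delta$ a finite set of declarations $\alpha:B$, ''$\pi$ is a proof-term of $\Delta\vdash_{\mathcal R}A$'' is defined inductively: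 $\alpha$ proves $A$ if $\alpha:B\in\Delta$ and $B\longrightarrow_{-}C\longleftarrow_{+}A$ for some $C$; if $\pi$ proves $\Delta,\alpha:A\vdash B$ and $C\longrightarrow_{+}(A\Rightarrow B)$ then $\lambda\alpha\,\pi$ proves $\Delta\vdash C$; if $\pi_1$ proves $\Delta\vdash C$, $C\longrightarrow_{-}(A\Rightarrow B)$ and $\pi_2$ proves $\Delta\vdash A$ then $(\pi_1\,\pi_2)$ proves $\Delta\vdash B$; if $\pi_1$ proves $\Delta\vdash A$, $\pi_2$ proves $\Delta\vdash B$ and $C\longrightarrow_{+}(A\wedge B)$ then $\langle\pi_1,\pi_2\rangle$ proves $\Delta\vdash C$; if $\pi$ proves $\Delta\vdash C$ and $C\longrightarrow_{-}(A\wedge B)$ then $\mathit{fst}(\pi)$ proves $\Delta\vdash A$ and $\mathit{snd}(\pi)$ proves $\Delta\vdash B$; if $\pi$ proves $\Delta\vdash A$ (resp. $\Delta\vdash B$) and $C\longrightarrow_{+}(A\vee B)$ then $i(\pi)$ (resp. $j(\pi)$) proves $\Delta\vdash C$; if $\pi_1$ proves $\Delta\vdash D$, $D\longrightarrow_{-}(A\vee B)$, $\pi_2$ proves $\Delta,\alpha:A\vdash C$ and $\pi_3$ proves $\Delta,\beta:B\vdash C$ then $\delta(\pi_1,\alpha\pi_2,\beta\pi_3)$ proves $\Delta\vdash C$; if $\pi$ proves $\Delta\vdash B$ and $B\longrightarrow_{-}\bot$ then $\delta_\bot(\pi)$ proves $\Delta\vdash A$ for any $A$. One-step reduction $\triangleright^1$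 is the closure under term contexts of $(\lambda\alpha\,\pi_1\;\pi_2)\triangleright[\pi_2/\alpha]\pi_1$, $\mathit{fst}(\langle\pi_1,\pi_2\rangle)\triangleright\pi_1$, $\mathit{snd}(\langle\pi_1,\pi_2\rangle)\triangleright\pi_2$, $\delta(i(\pi_1),\alpha\pi_2,\beta\pi_3)\triangleright[\pi_1/\alpha]\pi_2$, $\delta(j(\pi_1),\alpha\pi_2,\beta\pi_3)\triangleright[\pi_1/\beta]\pi_3$; a proof-term is strongly normalizable if no infinite $\triangleright^1$-sequence starts from it. Polarized classical sequent calculus modulo $\mathcal R$: sequents $\Delta\vdash_{\mathcal R}\Theta$ with $\Delta,\Theta$ finite multisets of propositions; rules: (axiom) $A\vdash B$ if $A\longrightarrow_{-}C\longleftarrow_{+}B$ for some $C$; (cut) from $\Delta,A\vdash\Theta$ and $\Delta\vdash B,\Theta$ infer $\Delta\vdash\Theta$ if $A\longleftarrow_{-}C\longrightarrow_{+}B$ for some $C$; (contr-left) from $\Delta,B_1,B_2\vdash\Theta$ infer $\Delta,A\vdash\Theta$ if $A\longrightarrow_{-}B_1$ and $A\longrightarrow_{-}B_2$; (contr-right) from $\Delta\vdash B_1,B_2,\Theta$ infer $\Delta\vdash A,\Theta$ if $A\longrightarrow_{+}B_1$ and $A\longrightarrow_{+}B_2$; (weak-left/right) from $\Delta\vdash\Theta$ infer $\Delta,A\vdash\Theta$ and $\Delta\vdash A,\Theta$; ($\Rightarrow$-left) from $\Delta\vdash A,\Theta$ and $\Delta,B\vdash\Theta$ infer $\Delta,C\vdash\Theta$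 if $C\longrightarrow_{-}(A\Rightarrow B)$; ($\Rightarrow$-right) from $\Delta,A\vdash B,\Theta$ infer $\Delta\vdash C,\Theta$ if $C\longrightarrow_{+}(A\Rightarrow B)$; ($\wedge$-left) from $\Delta,A,B\vdash\Theta$ infer $\Delta,C\vdash\Theta$ if $C\longrightarrow_{-}(A\wedge B)$; ($\wedge$-right) from $\Delta\vdash A,\Theta$ and $\Delta\vdash B,\Theta$ infer $\Delta\vdash C,\Theta$ if $C\longrightarrow_{+}(A\wedge B)$; ($\vee$-left) from $\Delta,A\vdash\Theta$ and $\Delta,B\vdash\Theta$ infer $\Delta,C\vdash\Theta$ if $C\longrightarrow_{-}(A\vee B)$; ($\vee$-right) from $\Delta\vdash A,B,\Theta$ infer $\Delta\vdash C,\Theta$ if $C\longrightarrow_{+}(A\vee B)$; ($\bot$-left) $\Delta,A\vdash\Theta$ if $A\longrightarrow_{-}\bot$. *)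

(* Defs.v *)
From Stdlib Require Import List Permutation Relations.
Import ListNotations.

Set Implicit Arguments.

Inductive form (atom : Type) : Type :=
| Atom (P : atom)
| Bot
| Imp (A B : form atom)
| And (A B : form atom)
| Or (A B : form atom).

Arguments Atom {atom} P.
Arguments Bot {atom}.

Definition Neg {atom : Type} (A : form atom) : form atom := Imp A Bot.

Definition theory (atom : Type) : Type := form atom -> Prop.

Definition add {atom : Type} (Gamma : theory atom) (A : form atom) : theory atom :=
  fun B => Gamma B \/ B = A.

(* Classical natural deduction from a possibly infinite set of
   hypotheses. *)
Inductive derives {atom : Type} : theory atom -> form atom -> Prop :=
| d_hyp Gamma A : Gamma A -> derives Gamma A
| d_imp_intro Gamma A B : derives (add Gamma A) B -> derives Gamma (Imp A B)
| d_imp_elim Gamma A B :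
    derives Gamma (Imp A B) -> derives Gamma A -> derives Gamma B
| d_and_intro Gamma A B :
    derives Gamma A -> derives Gamma B -> derives Gamma (And A B)
| d_and_elim1 Gamma A B : derives Gamma (And A B) -> derives Gamma A
| d_and_elim2 Gamma A B : derives Gamma (And A B) -> derives Gamma B
| d_or_intro1 Gamma A B : derives Gamma A -> derives Gamma (Or A B)
| d_or_intro2 Gamma A B : derives Gamma B -> derives Gamma (Or A B)
| d_or_elim Gamma A B C :
    derives Gamma (Or A B) -> derives (add Gamma A) C ->
    derives (add Gamma B) C -> derives Gamma C
| d_raa Gamma A : derives (add Gamma (Neg A)) Bot -> derives Gamma A.

Definition consistent {atom : Type} (Gamma : theory atom) : Prop :=
  ~ derives Gamma Bot.

(* [neg_rule R P A] means that P --> A is a negative rule of R, and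
   [pos_rule R P A] that it is a positive one. *)
Record rewrite_system (atom : Type) : Type := RewriteSystem {
  neg_rule : atom -> form atom -> Prop;
  pos_rule : atom -> form atom -> Prop
}.

Inductive theory_of {atom : Type} (R : rewrite_system atom) : theory atom :=
| theory_of_neg P A : neg_rule R P A -> theory_of R (Imp (Atom P) A)
| theory_of_pos P A : pos_rule R P A -> theory_of R (Imp A (Atom P)).

Definition presents {atom : Type} (R : rewrite_system atom) (Gamma : theory atom)
  : Prop :=
  forall A, derives (theory_of R) A <-> derives Gamma A.

Inductive sign : Type := Minus | Plus.

Definition opp (s : sign) : sign :=
  match s with Minus => Plus | Plus => Minus end.

Inductive step {atom : Type} (R : rewrite_system atom)
  : sign -> form atom -> form atom -> Prop :=
| step_neg P A : neg_rule R P A -> step R Minus (Atom P) A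
| step_pos P A : pos_rule R P A -> step R Plus (Atom P) A
| step_imp1 s A A' B : step R (opp s) A A' -> step R s (Imp A B) (Imp A' B)
| step_imp2 s A B B' : step R s B B' -> step R s (Imp A B) (Imp A B')
| step_and1 s A A' B : step R s A A' -> step R s (And A B) (And A' B)
| step_and2 s A B B' : step R s B B' -> step R s (And A B) (And A B')
| step_or1 s A A' B : step R s A A' -> step R s (Or A B) (Or A' B)
| step_or2 s A B B' : step R s B B' -> step R s (Or A B) (Or A B').

Definition rew {atom : Type} (R : rewrite_system atom) (s : sign)
  : form atom -> form atom -> Prop :=
  clos_refl_trans (form atom) (step R s).

Definition commuting {atom : Type} (R : rewrite_system atom) : Prop :=
  forall A B C, rew R Minus B A -> rew R Plus B C ->
    exists D, rew R Plus A D /\ rew R Minus C D.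

(* Proof-terms up to renaming of bound variables, with de Bruijn indices:
   [Lam] binds index 0 of its argument, and [Delta p q r] binds index 0 of q
   and index 0 of r. *)
Inductive term : Type :=
| Var (n : nat)
| Lam (p : term)
| App (p q : term)
| Pair (p q : term)
| Fst (p : term)
| Snd (p : term)
| Inl (p : term)
| Inr (p : term)
| Delta (p q r : term)
| DeltaBot (p : term).

Definition up_ren (f : nat -> nat) (n : nat) : nat :=
  match n with O => O | S m => S (f m) end.

Fixpoint rename (f : nat -> nat) (t : term) : term :=
  match t with
  | Var n => Var (f n)
  | Lam p => Lam (rename (up_ren f) p)
  | App p q => App (rename f p) (rename f q)
  | Pair p q => Pair (rename f p) (rename f q)
  | Fst p => Fst (rename f p)
  | Snd p => Snd (rename f p)
  | Inl p => Inl (rename f p)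
  | Inr p => Inr (rename f p)
  | Delta p q r =>
      Delta (rename f p) (rename (up_ren f) q) (rename (up_ren f) r)
  | DeltaBot p => DeltaBot (rename f p)
  end.

Definition up (f : nat -> term) (n : nat) : term :=
  match n with O => Var O | S m => rename S (f m) end.

Fixpoint subst (f : nat -> term) (t : term) : term :=
  match t with
  | Var n => f n
  | Lam p => Lam (subst (up f) p)
  | App p q => App (subst f p) (subst f q)
  | Pair p q => Pair (subst f p) (subst f q)
  | Fst p => Fst (subst f p)
  | Snd p => Snd (subst f p)
  | Inl p => Inl (subst f p)
  | Inr p => Inr (subst f p)
  | Delta p q r => Delta (subst f p) (subst (up f) q) (subst (up f) r)
  | DeltaBot p => DeltaBot (subst f p)
  end.

(* [subst0 u t] is [u/0]t for t living under one binder: the other indices of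
   t are decremented. *)
Definition subst0 (u t : term) : term :=
  subst (fun n => match n with O => u | S m => Var m end) t.

Inductive red : term -> term -> Prop :=
| red_beta p q : red (App (Lam p) q) (subst0 q p)
| red_fst p q : red (Fst (Pair p q)) p
| red_snd p q : red (Snd (Pair p q)) q
| red_inl p q r : red (Delta (Inl p) q r) (subst0 p q)
| red_inr p q r : red (Delta (Inr p) q r) (subst0 p r)
| red_Lam p p' : red p p' -> red (Lam p) (Lam p')
| red_App1 p p' q : red p p' -> red (App p q) (App p' q)
| red_App2 p q q' : red q q' -> red (App p q) (App p q')
| red_Pair1 p p' q : red p p' -> red (Pair p q) (Pair p' q)
| red_Pair2 p q q' : red q q' -> red (Pair p q) (Pair p q')
| red_Fst p p' : red p p' -> red (Fst p) (Fst p')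
| red_Snd p p' : red p p' -> red (Snd p) (Snd p')
| red_Inl p p' : red p p' -> red (Inl p) (Inl p')
| red_Inr p p' : red p p' -> red (Inr p) (Inr p')
| red_Delta1 p p' q r : red p p' -> red (Delta p q r) (Delta p' q r)
| red_Delta2 p q q' r : red q q' -> red (Delta p q r) (Delta p q' r)
| red_Delta3 p q r r' : red r r' -> red (Delta p q r) (Delta p q r')
| red_DeltaBot p p' : red p p' -> red (DeltaBot p) (DeltaBot p').

Definition strongly_normalizable (t : term) : Prop :=
  ~ exists f : nat -> term, f 0 = t /\ forall n, red (f n) (f (S n)).

(* [proves R ctx p A]: p is a proof-term of ctx |- A modulo R. The list ctx
   gives the type of the free variable n at position n. *)
Inductive proves {atom : Type} (R : rewrite_system atom)
  : list (form atom) -> term -> form atom -> Prop :=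
| p_var ctx n A B C :
    nth_error ctx n = Some B -> rew R Minus B C -> rew R Plus A C ->
    proves R ctx (Var n) A
| p_lam ctx p A B C :
    proves R (A :: ctx) p B -> rew R Plus C (Imp A B) ->
    proves R ctx (Lam p) C
| p_app ctx p q A B C :
    proves R ctx p C -> rew R Minus C (Imp A B) -> proves R ctx q A ->
    proves R ctx (App p q) B
| p_pair ctx p q A B C :
    proves R ctx p A -> proves R ctx q B -> rew R Plus C (And A B) ->
    proves R ctx (Pair p q) C
| p_fst ctx p A B C :
    proves R ctx p C -> rew R Minus C (And A B) -> proves R ctx (Fst p) A
| p_snd ctx p A B C :
    proves R ctx p C -> rew R Minus C (And A B) -> proves R ctx (Snd p) B
| p_inl ctx p A B C :
    proves R ctx p A -> rew R Plus C (Or A B) -> proves R ctx (Inl p) C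
| p_inr ctx p A B C :
    proves R ctx p B -> rew R Plus C (Or A B) -> proves R ctx (Inr p) C
| p_delta ctx p q r A B C D :
    proves R ctx p D -> rew R Minus D (Or A B) ->
    proves R (A :: ctx) q C -> proves R (B :: ctx) r C ->
    proves R ctx (Delta p q r) C
| p_delta_bot ctx p A B :
    proves R ctx p B -> rew R Minus B Bot -> proves R ctx (DeltaBot p) A.

Inductive cut_use : Type := WithCut | CutFree.

(* [sequent R WithCut] is provability in the sequent calculus modulo R, and
   [sequent R CutFree] is provability by a proof that does not use the cut
   rule. Multisets are represented by lists up to [Permutation] (rule [s_perm]);
   "Delta, A" and "A, Theta" are both written by consing A. *)
Inductive sequent {atom : Type} (R : rewrite_system atom) (c : cut_use)
  : list (form atom) -> list (form atom) -> Prop :=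
| s_perm D D' T T' :
    Permutation D D' -> Permutation T T' -> sequent R c D T -> sequent R c D' T'
| s_axiom A B C :
    rew R Minus A C -> rew R Plus B C -> sequent R c [A] [B]
| s_cut D T A B C :
    c = WithCut -> rew R Minus C A -> rew R Plus C B ->
    sequent R c (A :: D) T -> sequent R c D (B :: T) -> sequent R c D T
| s_contr_left D T A B1 B2 :
    rew R Minus A B1 -> rew R Minus A B2 ->
    sequent R c (B1 :: B2 :: D) T -> sequent R c (A :: D) T
| s_contr_right D T A B1 B2 :
    rew R Plus A B1 -> rew R Plus A B2 ->
    sequent R c D (B1 :: B2 :: T) -> sequent R c D (A :: T)
| s_weak_left D T A : sequent R c D T -> sequent R c (A :: D) T
| s_weak_right D T A : sequent R c D T -> sequent R c D (A :: T)
| s_imp_left D T A B C :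
    rew R Minus C (Imp A B) ->
    sequent R c D (A :: T) -> sequent R c (B :: D) T -> sequent R c (C :: D) T
| s_imp_right D T A B C :
    rew R Plus C (Imp A B) ->
    sequent R c (A :: D) (B :: T) -> sequent R c D (C :: T)
| s_and_left D T A B C :
    rew R Minus C (And A B) ->
    sequent R c (A :: B :: D) T -> sequent R c (C :: D) T
| s_and_right D T A B C :
    rew R Plus C (And A B) ->
    sequent R c D (A :: T) -> sequent R c D (B :: T) -> sequent R c D (C :: T)
| s_or_left D T A B C :
    rew R Minus C (Or A B) ->
    sequent R c (A :: D) T -> sequent R c (B :: D) T -> sequent R c (C :: D) T
| s_or_right D T A B C :
    rew R Plus C (Or A B) ->
    sequent R c D (A :: B :: T) -> sequent R c D (C :: T)
| s_bot_left D T A : rew R Minus A Bot -> sequent R c (A :: D) T.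

Definition cut_elimination {atom : Type} (R : rewrite_system atom) : Prop :=
  (forall ctx p A, proves R ctx p A -> strongly_normalizable p) /\
  (forall D T, sequent R WithCut D T -> sequent R CutFree D T).

(* Main.v *)
(** Fix a model [v] of [Gamma] and take, for every axiom [A] and every atom [P], the
    positive rule [P --> ~A] if [v] satisfies [P], and the negative rule [P --> A]
    otherwise. All these rules follow from [Gamma]; conversely a model of the rules
    either coincides with [v], or differs from it at some [P], whose rule then forces
    each axiom [A] to hold.

    No atom has rules of both signs, which is all that the other properties need.
    Positive and negative steps act on disjoint occurrences, hence commute. For
    normalization and for cut elimination, formulas are interpreted by reducibility
    candidates and by stable sets of cut-free sequents respectively: negative steps
    must enlarge the interpretation and positive ones shrink it, which holds for any
    right-hand sides if atoms with negative rules get the least interpretation and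
    the other atoms the greatest one. *)

From Stdlib Require Import List Permutation Relations Classical.
From Stdlib Require Import FunctionalExtensionality.
From mathcomp Require classical_sets.
Require Import Defs.
Import ListNotations.

Set Implicit Arguments.
Set Bullet Behavior "Strict Subproofs".

(** * Classical completeness *)

Fixpoint eval {atom : Type} (v : atom -> Prop) (A : form atom) : Prop :=
  match A with
  | Atom P => v P
  | Bot => False
  | Imp A B => eval v A -> eval v B
  | And A B => eval v A /\ eval v B
  | Or A B => eval v A \/ eval v B
  end.

Definition models {atom : Type} (v : atom -> Prop) (Gamma : theory atom) : Prop :=
  forall A, Gamma A -> eval v A.

Lemma models_add (atom : Type) (v : atom -> Prop) Gamma A :
  models v Gamma -> eval v A -> models v (add Gamma A).
Proof. intros HG HA B [HB | ->]; auto. Qed.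

Lemma derives_sound (atom : Type) (Gamma : theory atom) A :
  derives Gamma A -> forall v, models v Gamma -> eval v A.
Proof.
  induction 1; intros v Hv; simpl in *; auto using models_add.
  - now apply IHderives.
  - now apply (IHderives v).
  - destruct (IHderives1 v Hv); auto using models_add.
  - apply NNPP; intros HA. now apply (IHderives v), models_add.
Qed.

Lemma derives_weaken (atom : Type) (Gamma : theory atom) A :
  derives Gamma A ->
  forall Delta : theory atom, (forall B, Gamma B -> Delta B) -> derives Delta A.
Proof.
  assert (Hadd : forall (G D : theory atom) A, (forall B, G B -> D B) ->
            forall B, add G A B -> add D A B)
    by (unfold add; firstorder).
  induction 1; intros Delta HD.
  - now apply d_hyp, HD.
  - apply d_imp_intro; eauto.
  - eapply d_imp_elim; eauto.
  - apply d_and_intro; eauto.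
  - eapply d_and_elim1; eauto.
  - eapply d_and_elim2; eauto.
  - apply d_or_intro1; eauto.
  - apply d_or_intro2; eauto.
  - eapply d_or_elim; eauto.
  - apply d_raa; eauto.
Qed.

Lemma derives_trans (atom : Type) (Gamma : theory atom) A B :
  derives Gamma A -> derives (add Gamma A) B -> derives Gamma B.
Proof. intros HA HB. eapply d_imp_elim; [apply d_imp_intro, HB | exact HA]. Qed.

Lemma derives_exfalso (atom : Type) (Gamma : theory atom) A :
  derives Gamma Bot -> derives Gamma A.
Proof.
  intros H. apply d_raa. apply derives_weaken with Gamma; auto.
  now left.
Qed.

Definition lset {atom : Type} (l : list (form atom)) : theory atom :=
  fun A => In A l.

(** Serves the rules that discharge a hypothesis in [derives_compact]: of the finitely many
    hypotheses used, only those from [Gamma] have to be collected. *)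
Lemma list_add_split (atom : Type) (Gamma : theory atom) A l :
  (forall B, In B l -> add Gamma A B) ->
  exists l', (forall B, In B l' -> Gamma B) /\
    forall B, lset l B -> add (lset l') A B.
Proof.
  induction l as [| C l IH]; intros Hl.
  - exists nil; split; intros B [].
  - destruct IH as (l' & H1 & H2); [intros; apply Hl; now right |].
    destruct (Hl C (or_introl eq_refl)) as [HC | ->].
    + exists (C :: l'); split; intros B [<- | HB]; auto.
      * left; now left.
      * destruct (H2 B HB) as [H | H]; [left; now right | now right].
    + exists l'; split; auto. intros B [<- | HB]; auto. now right.
Qed.

(** Derivations are finite trees, so the hypotheses used can be gathered rule by rule. This carries
    consistency over to unions of chains. *)
Lemma derives_compact (atom : Type) (Gamma : theory atom) A :
  derives Gamma A ->
  exists l, (forall B, In B l -> Gamma B) /\ derives (lset l) A.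
Proof.
  assert (Hadd : forall (G : theory atom) A C,
    (exists l, (forall B, In B l -> add G A B) /\ derives (lset l) C) ->
    exists l, (forall B, In B l -> G B) /\ derives (add (lset l) A) C).
  { intros G A' C (l & Hl & HC).
    destruct (list_add_split _ Hl) as (l' & H1 & H2).
    exists l'; split; auto. eapply derives_weaken; eauto. }
  assert (Happ : forall (G : theory atom) l l',
    (forall B, In B l -> G B) -> (forall B, In B l' -> G B) ->
    forall B, In B (l ++ l') -> G B).
  { intros G l l' H H' B HB. apply in_app_or in HB. destruct HB; auto. }
  assert (HL : forall (l l' : list (form atom)) B, lset l B -> lset (l ++ l') B)
    by (intros; apply in_or_app; now left).
  assert (HR : forall (l l' : list (form atom)) B, lset l' B -> lset (l ++ l') B)
    by (intros; apply in_or_app; now right).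
  induction 1.
  - exists [A]; split; [| apply d_hyp; now left]. now intros B [<- | []].
  - destruct (Hadd _ _ _ IHderives) as (l & Hl & HC).
    exists l; split; auto. now apply d_imp_intro.
  - destruct IHderives1 as (l1 & Hl1 & H1), IHderives2 as (l2 & Hl2 & H2).
    exists (l1 ++ l2); split; [now apply Happ |].
    eapply d_imp_elim; eapply derives_weaken; eauto.
  - destruct IHderives1 as (l1 & Hl1 & H1), IHderives2 as (l2 & Hl2 & H2).
    exists (l1 ++ l2); split; [now apply Happ |].
    eapply d_and_intro; eapply derives_weaken; eauto.
  - destruct IHderives as (l & Hl & HC). exists l; split; auto.
    eapply d_and_elim1; eauto.
  - destruct IHderives as (l & Hl & HC). exists l; split; auto.
    eapply d_and_elim2; eauto.
  - destruct IHderives as (l & Hl & HC). exists l; split; auto.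
    eapply d_or_intro1; eauto.
  - destruct IHderives as (l & Hl & HC). exists l; split; auto.
    eapply d_or_intro2; eauto.
  - destruct IHderives1 as (l1 & Hl1 & H1'),
      (Hadd _ _ _ IHderives2) as (l2 & Hl2 & H2'),
      (Hadd _ _ _ IHderives3) as (l3 & Hl3 & H3').
    exists (l1 ++ l2 ++ l3); split; [repeat apply Happ; auto |].
    eapply d_or_elim.
    + eapply derives_weaken; eauto.
    + eapply derives_weaken; [exact H2' |].
      intros C' [HC | HC]; [left; auto | now right].
    + eapply derives_weaken; [exact H3' |].
      intros C' [HC | HC]; [left; auto | now right].
  - destruct (Hadd _ _ _ IHderives) as (l & Hl & HC).
    exists l; split; auto. now apply d_raa.
Qed.

Definition union {atom : Type} (Gamma X : theory atom) : theory atom :=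
  fun A => Gamma A \/ X A.

(** Induction on the list, keeping the larger of two comparable members of the chain. The first
    alternative is there because the chain may be empty. *)
Lemma list_in_chain (T : Type) (F : (T -> Prop) -> Prop) (Gamma : T -> Prop) l :
  classical_sets.total_on F classical_sets.subset ->
  (forall B, In B l -> Gamma B \/ exists2 X, F X & X B) ->
  (forall B, In B l -> Gamma B) \/
  exists X, F X /\ forall B, In B l -> Gamma B \/ X B.
Proof.
  intros HF. induction l as [| C l IH]; intros Hl.
  - left. intros B [].
  - assert (Hl' := fun B HB => Hl B (or_intror HB)).
    destruct (IH Hl') as [IH' | (X & HX & IH')];
      destruct (Hl C (or_introl eq_refl)) as [HC | [Y HY HC]].
    + left. intros B [<- | HB]; auto.
    + right. exists Y; split; auto. intros B [<- | HB]; auto.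
    + right. exists X; split; auto. intros B [<- | HB]; auto.
    + right. destruct (HF _ _ HX HY) as [S | S].
      * exists Y; split; auto. intros B [<- | HB]; auto.
        destruct (IH' B HB); auto.
      * exists X; split; auto. intros B [<- | HB]; auto.
Qed.

Lemma lindenbaum (atom : Type) (Gamma : theory atom) :
  consistent Gamma ->
  exists M : theory atom, (forall A, Gamma A -> M A) /\ consistent M /\
    forall A, consistent (add M A) -> M A.
Proof.
  intros HG.
  (* Zorn's lemma also asks about the empty chain, whose union is empty. Ordering the sets [X] for
     which [union Gamma X] is consistent, instead of the consistent supersets of [Gamma], reduces
     that case to the consistency of [Gamma]. *)
  destruct (classical_sets.Zorn_bigcup
              (T := form atom) (P := fun X => consistent (union Gamma X)))
    as (X & HX & Hmax).
  - intros F HF Hchain HB.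
    destruct (derives_compact HB) as (l & Hl & Hbot).
    destruct (list_in_chain (F := F) Gamma l Hchain) as [H | (X & FX & H)].
    + intros B HBl. destruct (Hl B HBl) as [H | [Y FY YB]]; [now left | right].
      now exists Y.
    + apply HG. eapply derives_weaken; eauto.
    + apply (HF X FX). eapply derives_weaken; eauto.
  - exists (union Gamma X). split; [now left |]. split; [exact HX |].
    intros A HA. apply NNPP; intros HnA.
    apply (Hmax (add X A)).
    + split; [now left |]. intros Hsub. apply HnA. right. apply Hsub. now right.
    + intros HB. apply HA. eapply derives_weaken; [exact HB |].
      unfold union, add; tauto.
Qed.

(** The truth lemma: [M] is deductively closed ([Hded]) and refutes every formula outside it
    ([Hneg]), which settles each connective. *)
Lemma maximal_truth (atom : Type) (M : theory atom) :
  consistent M -> (forall A, consistent (add M A) -> M A) ->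
  forall A, eval (fun P => M (Atom P)) A <-> M A.
Proof.
  intros Hc Hmax.
  assert (Hded : forall A, derives M A -> M A).
  { intros A HA. apply Hmax. intros HB. apply Hc. eapply derives_trans; eauto. }
  assert (Hneg : forall A, ~ M A -> derives (add M A) Bot).
  { intros A HA. apply NNPP. intros HB. apply HA, Hmax, HB. }
  assert (Hweak : forall A B, derives M B -> derives (add M A) B).
  { intros A B HB. eapply derives_weaken; [exact HB |]. now left. }
  induction A as [P | | A IHA B IHB | A IHA B IHB | A IHA B IHB]; simpl.
  - tauto.
  - split; [tauto |]. intros H. apply Hc. now apply d_hyp.
  - rewrite IHA, IHB. split.
    + intros H. destruct (classic (M A)) as [HA | HA].
      * apply Hded, d_imp_intro, Hweak, d_hyp; auto.
      * apply Hded, d_imp_intro, derives_exfalso, Hneg, HA.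
    + intros H HA. apply Hded. eapply d_imp_elim; apply d_hyp; eauto.
  - rewrite IHA, IHB. split.
    + intros [HA HB]. apply Hded, d_and_intro; now apply d_hyp.
    + intros H. split; apply Hded;
        [eapply d_and_elim1 | eapply d_and_elim2]; apply d_hyp; eauto.
  - rewrite IHA, IHB. split.
    + intros [HA | HB]; apply Hded;
        [apply d_or_intro1 | apply d_or_intro2]; now apply d_hyp.
    + intros H. apply NNPP. intros HN. apply Hc.
      apply d_or_elim with A B; [now apply d_hyp | |]; apply Hneg; tauto.
Qed.

Lemma consistent_model (atom : Type) (Gamma : theory atom) :
  consistent Gamma -> exists v, models v Gamma.
Proof.
  intros H. destruct (lindenbaum H) as (M & HM & Hc & Hmax).
  exists (fun P => M (Atom P)). intros A HA. apply maximal_truth; auto.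
Qed.

(** If [A] is not derivable, reductio ad absurdum makes [add Gamma (Neg A)] consistent, and a model
    of it is a countermodel. *)
Lemma derives_complete (atom : Type) (Gamma : theory atom) A :
  (forall v, models v Gamma -> eval v A) -> derives Gamma A.
Proof.
  intros H. apply NNPP. intros HA.
  destruct (@consistent_model atom (add Gamma (Neg A))) as [v Hv].
  - intros HB. apply HA, d_raa, HB.
  - apply (Hv (Neg A) (or_intror eq_refl)). apply H.
    intros B HB. apply Hv. now left.
Qed.

(** * Separated rewrite systems and commutation *)

Definition separated {atom : Type} (R : rewrite_system atom) : Prop :=
  forall P A B, neg_rule R P A -> pos_rule R P B -> False.

(** Both steps could meet only at an atom, which separation excludes. In the same component the
    induction hypothesis closes the diagram; in different components each step is replayed after the
    other. The sign is arbitrary because the left of an implication reverses it. *)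
Lemma step_commute (atom : Type) (R : rewrite_system atom) :
  separated R ->
  forall s A B, step R s A B -> forall C, step R (opp s) A C ->
  exists D, step R (opp s) B D /\ step R s C D.
Proof.
  intros HR s A B HAB.
  assert (Hopp : forall s, opp (opp s) = s) by now intros [].
  induction HAB; intros D HD; simpl in HD; inversion HD; subst;
    try solve [exfalso; eapply HR; eauto];
    try (match goal with
         | IH : forall C, step _ _ _ C -> _, H : step _ _ _ _ |- _ =>
             destruct (IH _ H) as (E & H1 & H2)
         end; eexists; split; constructor; eauto; fail);
    try (eexists; split; [| econstructor; eauto]; constructor; eauto; fail).
Qed.

(** Tiling with one-step diagrams: [strip] moves one positive step across a sequence of negative
    ones, and an induction on the positive sequence stacks the strips. *)
Lemma commuting_separated (atom : Type) (R : rewrite_system atom) :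
  separated R -> commuting R.
Proof.
  intros HR.
  assert (strip : forall A B, rew R Minus B A -> forall C, step R Plus B C ->
            exists D, step R Plus A D /\ rew R Minus C D).
  { intros A B H. apply clos_rt_rt1n in H.
    induction H as [B | B B' A HBB' _ IH]; intros C HC.
    - exists C; split; [exact HC | apply rt_refl].
    - destruct (step_commute HR HBB' HC) as (C' & H1 & H2).
      destruct (IH C' H1) as (D & H3 & H4).
      exists D; split; [exact H3 |]. eapply rt_trans; [apply rt_step |]; eauto. }
  intros A B C HA HC. apply clos_rt_rt1n in HC. revert A HA.
  induction HC as [B | B B' C HBB' _ IH]; intros A HA.
  - exists A; split; [apply rt_refl | exact HA].
  - destruct (strip _ _ HA _ HBB') as (A' & H1 & H2).
    destruct (IH A' H2) as (D & H3 & H4).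
    exists D; split; [| exact H4]. eapply rt_trans; [apply rt_step |]; eauto.
Qed.

(** The denotation is arbitrary because this serves twice: with proof-terms as points for
    reducibility, and with conditions as points for forcing. *)
Lemma rew_monotone (atom : Type) (R : rewrite_system atom) (I : Type)
    (den : form atom -> I -> Prop) :
  (forall s A B, step R s A B -> forall x,
     match s with Minus => den A x -> den B x | Plus => den B x -> den A x end) ->
  forall s A B, rew R s A B -> forall x,
     match s with Minus => den A x -> den B x | Plus => den B x -> den A x end.
Proof.
  intros H s A B HAB. induction HAB as [A B HS | A | A B C _ IH1 _ IH2]; intros x.
  - now apply H.
  - now destruct s.
  - specialize (IH1 x); specialize (IH2 x); destruct s; auto.
Qed.

(** * Substitution in proof-terms *)

Definition scons (u : term) (f : nat -> term) (n : nat) : term :=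
  match n with O => u | S m => f m end.

(** The composition lemmas build on each other: under a binder, [rename_subst] needs
    [rename_rename], and [subst_subst] needs [subst_rename] and [rename_subst]. *)
Lemma rename_rename t : forall f g,
  rename g (rename f t) = rename (fun n => g (f n)) t.
Proof.
  assert (Hup : forall f g, (fun n => up_ren g (up_ren f n)) = up_ren (fun n => g (f n)))
    by (intros; apply functional_extensionality; now intros []).
  induction t; intros; simpl; f_equal; auto;
    match goal with IH : context [_ = _] |- _ => now rewrite IH, Hup end.
Qed.

Lemma subst_rename t : forall f g,
  subst g (rename f t) = subst (fun n => g (f n)) t.
Proof.
  assert (Hup : forall f g, (fun n => up g (up_ren f n)) = up (fun n => g (f n)))
    by (intros; apply functional_extensionality; now intros []).
  induction t; intros; simpl; f_equal; auto;
    match goal with IH : context [_ = _] |- _ => now rewrite IH, Hup end.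
Qed.

Lemma rename_subst t : forall f g,
  rename g (subst f t) = subst (fun n => rename g (f n)) t.
Proof.
  assert (Hup : forall f g,
    (fun n => rename (up_ren g) (up f n)) = up (fun n => rename g (f n))).
  { intros; apply functional_extensionality; intros []; simpl; auto.
    now rewrite !rename_rename. }
  induction t; intros; simpl; f_equal; auto;
    match goal with IH : context [_ = _] |- _ => now rewrite IH, Hup end.
Qed.

Lemma subst_subst t : forall f g,
  subst g (subst f t) = subst (fun n => subst g (f n)) t.
Proof.
  assert (Hup : forall f g, (fun n => subst (up g) (up f n)) = up (fun n => subst g (f n))).
  { intros; apply functional_extensionality; intros []; simpl; auto.
    now rewrite subst_rename, rename_subst. }
  induction t; intros; simpl; f_equal; auto;
    match goal with IH : context [_ = _] |- _ => now rewrite IH, Hup end.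
Qed.

Lemma subst_Var t : subst Var t = t.
Proof.
  assert (Hup : up Var = Var)
    by (apply functional_extensionality; now intros []).
  induction t; simpl; rewrite ?Hup; f_equal; auto.
Qed.

(** Turns the contraction of a redex whose body already carries a substitution into the extended
    substitution that the induction hypotheses of [proves_reducible] accept. *)
Lemma subst0_subst_up u f t : subst0 u (subst (up f) t) = subst (scons u f) t.
Proof.
  unfold subst0. rewrite subst_subst. f_equal.
  apply functional_extensionality; intros []; simpl; auto.
  now rewrite subst_rename, subst_Var.
Qed.

Lemma subst_subst0 u f t : subst f (subst0 u t) = subst0 (subst f u) (subst (up f) t).
Proof.
  rewrite subst0_subst_up. unfold subst0. rewrite subst_subst. f_equal.
  apply functional_extensionality; now intros [].
Qed.

Lemma red_subst t t' : red t t' -> forall f, red (subst f t) (subst f t').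
Proof.
  induction 1; intros f; simpl; rewrite ?subst_subst0; constructor; auto.
Qed.

(** * Reducibility candidates *)

Definition SN : term -> Prop := Acc (fun t' t => red t t').

Lemma SN_strongly_normalizable t : SN t -> strongly_normalizable t.
Proof.
  induction 1 as [t _ IH]. intros (f & <- & Hf).
  apply (IH (f 1)); [apply Hf |]. exists (fun n => f (S n)); auto.
Qed.

Lemma SN_subst_inv f t : SN (subst f t) -> SN t.
Proof.
  remember (subst f t) as u eqn:E. intros H. revert t E.
  induction H as [u _ IH]; intros t ->. constructor; intros t' Ht'.
  eapply IH; [apply red_subst, Ht' | reflexivity].
Qed.

Definition reds : term -> term -> Prop := clos_refl_trans_1n term red.

(** Eliminating such a term creates no redex at the root. *)
Definition neutral (t : term) : Prop :=
  match t with Lam _ | Pair _ _ | Inl _ | Inr _ => False | _ => True end.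

(** Girard's conditions CR1, CR2 and CR3. *)
Record candidate (X : term -> Prop) : Prop := Candidate {
  cand_SN : forall t, X t -> SN t;
  cand_red : forall t t', X t -> red t t' -> X t';
  cand_neutral : forall t, neutral t -> (forall t', red t t' -> X t') -> X t
}.

Lemma cand_reds X t t' : candidate X -> reds t t' -> X t -> X t'.
Proof.
  intros HX. induction 1 as [| t t1 t2 Hr _ IH]; auto.
  intros Ht. apply IH. eapply (cand_red HX); eauto.
Qed.

Lemma cand_Var X n : candidate X -> X (Var n).
Proof. intros HX. apply cand_neutral; simpl; auto. intros t' H; inversion H. Qed.

Lemma candidate_SN : candidate SN.
Proof.
  split; auto.
  - intros t t' [H]. apply H.
  - intros t _ H. now constructor.
Qed.

(* Every connective is interpreted by a condition [W] on the values to which a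
   strongly normalizable term reduces. *)
Definition values (W : term -> Prop) (t : term) : Prop :=
  SN t /\ forall v, reds t v -> neutral v \/ W v.

(** Holds for every [W]: [values] speaks of all reducts, hence is stable under reduction, and a
    neutral term is itself unconstrained while its proper reducts pass through a one-step reduct. *)
Lemma candidate_values W : candidate (values W).
Proof.
  split.
  - now intros t [].
  - intros t t' [H1 H2] Hr. split; [eapply (cand_red candidate_SN); eauto |].
    intros v Hv. apply H2. eapply Relation_Operators.rt1n_trans; eauto.
  - intros t Ht H. split; [constructor; apply H |].
    intros v Hv. destruct Hv as [| t' v Hr Hv]; [now left |]. eapply H; eauto.
Qed.

Lemma values_monotone (W W' : term -> Prop) t :
  (forall v, W v -> W' v) -> values W t -> values W' t.
Proof. intros H [H1 H2]; split; auto. intros v Hv. destruct (H2 v Hv); auto. Qed.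

Lemma values_value W v : values W v -> ~ neutral v -> W v.
Proof. intros [_ H] Hn. destruct (H v); [constructor | tauto | auto]. Qed.

(** Introductions of other connectives are unconstrained: applying one forms no redex at the root.
    [product] and [sum] follow the same convention. *)
Definition arrow (X Y : term -> Prop) : term -> Prop :=
  values (fun v => match v with
    | Lam p => forall u, X u -> Y (subst0 u p) | _ => True end).

Definition product (X Y : term -> Prop) : term -> Prop :=
  values (fun v => match v with Pair p q => X p /\ Y q | _ => True end).

Definition sum (X Y : term -> Prop) : term -> Prop :=
  values (fun v => match v with Inl p => X p | Inr p => Y p | _ => True end).

Lemma reds_Lam_inv p t : reds (Lam p) t -> exists p', t = Lam p' /\ reds p p'.
Proof.
  remember (Lam p) as u eqn:E. intros H. revert p E.
  induction H as [u | u t v H _ IH]; intros p ->.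
  - exists p; split; auto. constructor.
  - inversion H; subst. destruct (IH p') as (p'' & -> & H'); auto.
    exists p''; split; auto. eapply Relation_Operators.rt1n_trans; eauto.
Qed.

Lemma reds_Pair_inv p q t :
  reds (Pair p q) t -> exists p' q', t = Pair p' q' /\ reds p p' /\ reds q q'.
Proof.
  remember (Pair p q) as u eqn:E. intros H. revert p q E.
  induction H as [u | u t v H _ IH]; intros p q ->.
  - exists p, q; repeat split; constructor.
  - inversion H; subst;
      (edestruct IH as (p1 & q1 & -> & H1 & H2); [reflexivity |];
       exists p1, q1; repeat split; auto;
       eapply Relation_Operators.rt1n_trans; eauto).
Qed.

Lemma reds_Inl_inv p t : reds (Inl p) t -> exists p', t = Inl p' /\ reds p p'.
Proof.
  remember (Inl p) as u eqn:E. intros H. revert p E.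
  induction H as [u | u t v H _ IH]; intros p ->.
  - exists p; split; auto. constructor.
  - inversion H; subst. destruct (IH p') as (p'' & -> & H'); auto.
    exists p''; split; auto. eapply Relation_Operators.rt1n_trans; eauto.
Qed.

Lemma reds_Inr_inv p t : reds (Inr p) t -> exists p', t = Inr p' /\ reds p p'.
Proof.
  remember (Inr p) as u eqn:E. intros H. revert p E.
  induction H as [u | u t v H _ IH]; intros p ->.
  - exists p; split; auto. constructor.
  - inversion H; subst. destruct (IH p') as (p'' & -> & H'); auto.
    exists p''; split; auto. eapply Relation_Operators.rt1n_trans; eauto.
Qed.

Lemma reds_subst t t' f : reds t t' -> reds (subst f t) (subst f t').
Proof.
  induction 1; [constructor |].
  eapply Relation_Operators.rt1n_trans; eauto using red_subst.
Qed.

Lemma SN_Lam p : SN p -> SN (Lam p).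
Proof.
  induction 1 as [p _ IH]. constructor; intros t Ht.
  inversion Ht; subst. now apply IH.
Qed.

Lemma SN_Inl p : SN p -> SN (Inl p).
Proof.
  induction 1 as [p _ IH]. constructor; intros t Ht.
  inversion Ht; subst. now apply IH.
Qed.

Lemma SN_Inr p : SN p -> SN (Inr p).
Proof.
  induction 1 as [p _ IH]. constructor; intros t Ht.
  inversion Ht; subst. now apply IH.
Qed.

Lemma SN_Pair p q : SN p -> SN q -> SN (Pair p q).
Proof.
  intros Hp. revert q. induction Hp as [p Hp IHp]. intros q Hq.
  induction Hq as [q Hq IHq]. constructor; intros t Ht.
  inversion Ht; subst; [apply IHp; auto; now constructor | now apply IHq].
Qed.

Lemma arrow_Lam X Y p : candidate X -> candidate Y ->
  (forall u, X u -> Y (subst0 u p)) -> arrow X Y (Lam p).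
Proof.
  intros HX HY H. split.
  (* The instance of the body by a variable, which every candidate contains, lies in [Y]; its strong
     normalization passes back to the body. *)
  - apply SN_Lam. eapply SN_subst_inv, cand_SN, H; [exact HY |].
    now apply (cand_Var 0).
  - intros v Hv. right. destruct (reds_Lam_inv Hv) as (p' & -> & Hp).
    intros u Hu. eapply cand_reds; [exact HY | apply reds_subst, Hp |]. now apply H.
Qed.

(** An application is neutral, so its one-step reducts suffice. Nested inductions on the strong
    normalization of [u] and [t] treat the inner steps; the root redex is covered by the condition
    on the values of [t]. *)
Lemma arrow_App X Y t u : candidate X -> candidate Y ->
  arrow X Y t -> X u -> Y (App t u).
Proof.
  intros HX HY Ht Hu.
  assert (Hsn := cand_SN HX u Hu). assert (Hsn' := proj1 Ht).
  revert t Hsn' Ht Hu. induction Hsn as [u _ IHu].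
  intros t Hsn'. induction Hsn' as [t Hst IHt]. intros Ht Hu.
  apply cand_neutral; simpl; auto. intros t' Hr. inversion Hr; subst.
  - apply (values_value Ht); auto.
  - apply IHt; auto. eapply (cand_red (candidate_values _)); eauto.
  - apply IHu; auto; [now constructor |]. eapply (cand_red HX); eauto.
Qed.

Lemma product_Pair X Y p q : candidate X -> candidate Y ->
  X p -> Y q -> product X Y (Pair p q).
Proof.
  intros HX HY Hp Hq. split.
  - apply SN_Pair; [apply (cand_SN HX) | apply (cand_SN HY)]; auto.
  - intros v Hv. right. destruct (reds_Pair_inv Hv) as (p' & q' & -> & Hp' & Hq').
    split; [eapply (cand_reds HX) | eapply (cand_reds HY)]; eauto.
Qed.

Lemma product_Fst X Y t : candidate X -> product X Y t -> X (Fst t).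
Proof.
  intros HX Ht. assert (Hsn := proj1 Ht). induction Hsn as [t _ IH].
  apply cand_neutral; simpl; auto. intros t' Hr. inversion Hr; subst.
  - apply (values_value Ht); auto.
  - apply IH; auto. eapply (cand_red (candidate_values _)); eauto.
Qed.

Lemma product_Snd X Y t : candidate Y -> product X Y t -> Y (Snd t).
Proof.
  intros HY Ht. assert (Hsn := proj1 Ht). induction Hsn as [t _ IH].
  apply cand_neutral; simpl; auto. intros t' Hr. inversion Hr; subst.
  - apply (values_value Ht); auto.
  - apply IH; auto. eapply (cand_red (candidate_values _)); eauto.
Qed.

Lemma sum_Inl X Y p : candidate X -> X p -> sum X Y (Inl p).
Proof.
  intros HX Hp. split.
  - apply SN_Inl, (cand_SN HX), Hp.
  - intros v Hv. right. destruct (reds_Inl_inv Hv) as (p' & -> & Hp').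
    eapply cand_reds; eauto.
Qed.

Lemma sum_Inr X Y p : candidate Y -> Y p -> sum X Y (Inr p).
Proof.
  intros HY Hp. split.
  - apply SN_Inr, (cand_SN HY), Hp.
  - intros v Hv. right. destruct (reds_Inr_inv Hv) as (p' & -> & Hp').
    eapply cand_reds; eauto.
Qed.

(** The scheme of [arrow_App] with three nested inductions. The branches are strongly normalizable
    because their instances by a variable lie in [Z]. *)
Lemma sum_Delta X Y Z t q r : candidate X -> candidate Y -> candidate Z ->
  sum X Y t -> (forall u, X u -> Z (subst0 u q)) ->
  (forall u, Y u -> Z (subst0 u r)) -> Z (Delta t q r).
Proof.
  intros HX HY HZ Ht Hq Hr.
  assert (Sq : SN q)
    by (eapply SN_subst_inv, (cand_SN HZ), Hq, (cand_Var 0 HX)).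
  assert (Sr : SN r)
    by (eapply SN_subst_inv, (cand_SN HZ), Hr, (cand_Var 0 HY)).
  assert (St := proj1 Ht).
  revert q Sq Hq r Sr Hr. induction St as [t St IHt].
  intros q Sq. induction Sq as [q Sq IHq]. intros Hq r Sr.
  induction Sr as [r Sr IHr]. intros Hr.
  apply cand_neutral; simpl; auto. intros t' Hred. inversion Hred; subst.
  - apply Hq, (values_value Ht); auto.
  - apply Hr, (values_value Ht); auto.
  - apply IHt; auto; [| now constructor | now constructor].
    eapply (cand_red (candidate_values _)); eauto.
  - apply IHq; auto; [| now constructor].
    intros u Hu. eapply (cand_red HZ); [apply Hq, Hu |]. now apply red_subst.
  - apply IHr; auto.
    intros u Hu. eapply (cand_red HZ); [apply Hr, Hu |]. now apply red_subst.
Qed.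

(** [DeltaBot t] is never a redex at the root, so it belongs to every candidate; this lets [Bot]
    denote [SN]. *)
Lemma cand_DeltaBot X t : candidate X -> SN t -> X (DeltaBot t).
Proof.
  intros HX. induction 1 as [t _ IH].
  apply cand_neutral; simpl; auto. intros t' Hr. inversion Hr; subst; auto.
Qed.

(* An atom with negative rules denotes the least candidate and any other atom
   the greatest one, so that in a separated system the rules are respected
   whatever their right-hand sides. *)
Fixpoint reducible {atom : Type} (R : rewrite_system atom) (A : form atom)
  : term -> Prop :=
  match A with
  | Atom P => fun t => SN t /\
      ((exists B, neg_rule R P B) -> forall X, candidate X -> X t)
  | Bot => SN
  | Imp A B => arrow (reducible R A) (reducible R B)
  | And A B => product (reducible R A) (reducible R B)
  | Or A B => sum (reducible R A) (reducible R B)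
  end.

Lemma candidate_reducible (atom : Type) (R : rewrite_system atom) A :
  candidate (reducible R A).
Proof.
  destruct A; simpl; try apply candidate_values.
  - split.
    + tauto.
    + intros t t' [H1 H2] Hr. split; [eapply (cand_red candidate_SN); eauto |].
      intros HP X HX. exact (cand_red HX (H2 HP X HX) Hr).
    + intros t Ht H. split; [constructor; apply H |].
      intros HP X HX. apply (cand_neutral HX); auto.
      intros t' Hr. now apply (H t' Hr).
  - apply candidate_SN.
Qed.

(** In the congruence cases, the sign reversal on the left of an implication matches the
    contravariance of [arrow]. *)
Lemma step_reducible (atom : Type) (R : rewrite_system atom) :
  separated R -> forall s A B, step R s A B -> forall t,
  match s with
  | Minus => reducible R A t -> reducible R B t
  | Plus => reducible R B t -> reducible R A t
  end.
Proof.
  intros HR s A B H. induction H; try destruct s; simpl in *;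
    try (intros t; apply values_monotone; intros []; firstorder; fail).
  - intros t [_ Ht]. apply Ht; [eauto | apply candidate_reducible].
  - intros t Ht. split.
    + eapply cand_SN; [apply candidate_reducible | exact Ht].
    + intros [B HB]. exfalso; eauto.
Qed.

(** The side conditions of the typing rules point the right way: an eliminated formula is rewritten
    negatively, which enlarges its denotation, and an introduced one is recovered backwards along
    positive steps, which also enlarges it. *)
Lemma proves_reducible (atom : Type) (R : rewrite_system atom) :
  separated R -> forall ctx p A, proves R ctx p A ->
  forall f, (forall n B, nth_error ctx n = Some B -> reducible R B (f n)) ->
  reducible R A (subst f p).
Proof.
  intros HR.
  assert (Hneg : forall A B, rew R Minus A B ->
    forall t, reducible R A t -> reducible R B t)
    by exact (rew_monotone _ (step_reducible HR) (s := Minus)).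
  assert (Hpos : forall A B, rew R Plus A B ->
    forall t, reducible R B t -> reducible R A t)
    by exact (rew_monotone _ (step_reducible HR) (s := Plus)).
  assert (HC := candidate_reducible R).
  assert (Hscons : forall A ctx f u, reducible R A u ->
    (forall n B, nth_error ctx n = Some B -> reducible R B (f n)) ->
    forall n B, nth_error (A :: ctx) n = Some B -> reducible R B (scons u f n)).
  { intros A ctx f u Hu Hf [| n] B; simpl; [now intros [= <-] | apply Hf]. }
  induction 1; intros f Hf; simpl.
  - eapply Hpos, Hneg; eauto.
  - eapply Hpos; eauto. apply arrow_Lam; auto.
    intros u Hu. rewrite subst0_subst_up. now apply IHproves, Hscons.
  - eapply arrow_App; [apply (HC A) | apply HC | eapply (Hneg _ (Imp A B)) |]; eauto.
  - eapply Hpos; eauto. apply (product_Pair _ _ (HC A) (HC B)); auto.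
  - eapply product_Fst; [apply HC | eapply (Hneg _ (And A B))]; eauto.
  - eapply product_Snd; [apply HC | eapply (Hneg _ (And A B))]; eauto.
  - eapply Hpos; eauto. apply (sum_Inl _ _ (HC A)); auto.
  - eapply Hpos; eauto. apply (sum_Inr _ _ (HC B)); auto.
  - eapply sum_Delta; [apply (HC A) | apply (HC B) | apply HC
      | eapply (Hneg _ (Or A B)); eauto | |];
      intros u Hu; rewrite subst0_subst_up;
      [apply IHproves2 | apply IHproves3]; now apply Hscons.
  - apply cand_DeltaBot; auto. eapply (Hneg _ Bot); eauto.
Qed.

Lemma proves_strongly_normalizable (atom : Type) (R : rewrite_system atom) :
  separated R -> forall ctx p A, proves R ctx p A -> strongly_normalizable p.
Proof.
  intros HR ctx p A Hp. apply SN_strongly_normalizable.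
  rewrite <- (subst_Var p).
  eapply cand_SN; [apply candidate_reducible | eapply proves_reducible; eauto].
  intros n B _. apply cand_Var, candidate_reducible.
Qed.

(** * Forcing over cut-free sequents *)

Lemma sequent_contract_left (atom : Type) (R : rewrite_system atom) c A D T :
  In A D -> sequent R c (A :: D) T -> sequent R c D T.
Proof.
  intros HA H. destruct (in_split _ _ HA) as (l1 & l2 & ->).
  eapply s_perm; [apply Permutation_middle | apply Permutation_refl |].
  eapply s_contr_left; [apply rt_refl | apply rt_refl |].
  eapply s_perm; [| apply Permutation_refl | exact H].
  apply perm_skip, Permutation_sym, Permutation_middle.
Qed.

Lemma sequent_contract_right (atom : Type) (R : rewrite_system atom) c A D T :
  In A T -> sequent R c D (A :: T) -> sequent R c D T.
Proof.
  intros HA H. destruct (in_split _ _ HA) as (l1 & l2 & ->).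
  eapply s_perm; [apply Permutation_refl | apply Permutation_middle |].
  eapply s_contr_right; [apply rt_refl | apply rt_refl |].
  eapply s_perm; [apply Permutation_refl | | exact H].
  apply perm_skip, Permutation_sym, Permutation_middle.
Qed.

(** Weaken to the concatenated contexts, then contract the old formulas away. Thus only the sets of
    formulas matter, as in [extends]. *)
Lemma sequent_incl (atom : Type) (R : rewrite_system atom) c D D' T T' :
  incl D D' -> incl T T' -> sequent R c D T -> sequent R c D' T'.
Proof.
  intros HD HT H.
  assert (H1 : sequent R c (D ++ D') (T ++ T')).
  { apply s_perm with (D' ++ D) (T' ++ T); [apply Permutation_app_comm .. |].
    clear HD HT.
    induction D' as [| A D' IH]; simpl; [| now apply s_weak_left].
    induction T' as [| B T' IH]; simpl; [exact H | now apply s_weak_right]. }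
  clear H.
  assert (H2 : sequent R c D' (T ++ T')).
  { induction D as [| A D IH]; auto. apply incl_cons_inv in HD as [HA HD].
    apply IH; auto. simpl in H1. eapply sequent_contract_left; [| exact H1].
    apply in_or_app; auto. }
  clear H1. induction T as [| B T IH]; auto. apply incl_cons_inv in HT as [HB HT].
  apply IH; auto. simpl in H2. eapply sequent_contract_right; [| exact H2].
  apply in_or_app; auto.
Qed.

Section Forcing.

Context {atom : Type} (R : rewrite_system atom).

Definition condition : Type := (list (form atom) * list (form atom))%type.

Definition extends (x y : condition) : Prop :=
  incl (fst x) (fst y) /\ incl (snd x) (snd y).

Definition closed (x : condition) : Prop := sequent R CutFree (fst x) (snd x).

(** Kripke negation with [closed] in the place of absurdity; the double orthogonal is the closure
    operator whose fixed points serve as denotations. *)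
Definition perp (X : condition -> Prop) (x : condition) : Prop :=
  forall y, extends x y -> X y -> closed y.

Definition hereditary (X : condition -> Prop) : Prop :=
  forall x y, extends x y -> X x -> X y.

(* As for candidates, an atom with negative rules is given the least admissible
   denotation and any other atom the greatest one. *)
Fixpoint forces (A : form atom) : condition -> Prop :=
  match A with
  | Atom P => fun x => perp (fun y => In (Atom P) (snd y)) x /\
      ((exists B, neg_rule R P B) -> perp (perp (fun y => In (Atom P) (fst y))) x)
  | Bot => closed
  | Imp A B => perp (fun x => forces A x /\ perp (forces B) x)
  | And A B => fun x => forces A x /\ forces B x
  | Or A B => perp (fun x => perp (forces A) x /\ perp (forces B) x)
  end.

Lemma extends_refl x : extends x x.
Proof. split; apply incl_refl. Qed.

Lemma extends_trans x y z : extends x y -> extends y z -> extends x z.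
Proof. intros [] []; split; eapply incl_tran; eauto. Qed.

Lemma closed_hereditary : hereditary closed.
Proof. intros x y [HD HT]. now apply sequent_incl. Qed.

Lemma perp_hereditary X : hereditary (perp X).
Proof. intros x y Hxy H z Hz. apply H. eapply extends_trans; eauto. Qed.

Lemma perp_antitone (X Y : condition -> Prop) x :
  (forall y, X y -> Y y) -> perp Y x -> perp X x.
Proof. unfold perp; auto. Qed.

Lemma perp_closed (X : condition -> Prop) x : perp X x -> X x -> closed x.
Proof. intros H. apply H, extends_refl. Qed.

Lemma perp_perp_intro X x : hereditary X -> X x -> perp (perp X) x.
Proof. intros HX Hx y Hy Hp. eapply perp_closed; eauto. Qed.

Lemma perp_stable X x : hereditary X -> perp (perp (perp X)) x -> perp X x.
Proof. intros HX H y Hy HXy. apply H; auto. now apply perp_perp_intro. Qed.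

Lemma hereditary_and X Y :
  hereditary X -> hereditary Y -> hereditary (fun x => X x /\ Y x).
Proof. intros HX HY x y Hxy []; split; eauto. Qed.

Lemma hereditary_left A : hereditary (fun y => In A (fst y)).
Proof. intros x y [H _]; apply H. Qed.

Lemma hereditary_right A : hereditary (fun y => In A (snd y)).
Proof. intros x y [_ H]; apply H. Qed.

Lemma forces_hereditary A : hereditary (forces A).
Proof.
  induction A; simpl; auto using perp_hereditary, closed_hereditary, hereditary_and.
  intros x y Hxy [H1 H2]. split; [| intros HP; specialize (H2 HP)];
    eapply perp_hereditary; eauto.
Qed.

(** Each clause is [closed], an orthogonal, or an intersection of stable sets. Stability is what
    makes this forcing classical. *)
Lemma forces_stable A x : perp (perp (forces A)) x -> forces A x.
Proof.
  revert x.
  induction A as [P | | A IHA B IHB | A IHA B IHB | A IHA B IHB]; simpl; intros x H.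
  - split; [| intros HP]; apply perp_stable;
      auto using hereditary_right, perp_hereditary.
    + revert H. apply perp_antitone; intros y; apply perp_antitone; tauto.
    + revert H. apply perp_antitone; intros y; apply perp_antitone; tauto.
  - apply (perp_closed H). intros y _ Hy; exact Hy.
  - apply perp_stable; auto.
    apply hereditary_and; auto using perp_hereditary, forces_hereditary.
  - split; [apply IHA | apply IHB]; revert H; apply perp_antitone; intros y;
      apply perp_antitone; tauto.
  - apply perp_stable; auto using hereditary_and, perp_hereditary.
Qed.

Definition add_left (A : form atom) (x : condition) : condition :=
  (A :: fst x, snd x).

Definition add_right (A : form atom) (x : condition) : condition :=
  (fst x, A :: snd x).

Lemma extends_add_left A x : extends x (add_left A x).
Proof. split; [apply incl_tl |]; apply incl_refl. Qed.

Lemma extends_add_right A x : extends x (add_right A x).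
Proof. split; [| apply incl_tl]; apply incl_refl. Qed.

Lemma closed_in_left A x : In A (fst x) -> closed (add_left A x) -> closed x.
Proof. apply sequent_contract_left. Qed.

Lemma closed_in_right A x : In A (snd x) -> closed (add_right A x) -> closed x.
Proof. apply sequent_contract_right. Qed.

(* Okada's lemma: this is what turns the forcing soundness of a derivation into a
   cut-free derivation of the same sequent. *)
Lemma forces_in A :
  (forall x, In A (fst x) -> forces A x) /\
  (forall x, In A (snd x) -> perp (forces A) x).
Proof.
  (* [Hl] and [Hr] recast the two halves of the statement for a subformula as cut-free premises of
     the logical rules. *)
  assert (Hl : forall A, (forall x, In A (snd x) -> perp (forces A) x) ->
    forall x, forces A x -> closed (add_right A x)).
  { intros C HC x Hx. eapply perp_closed; [apply HC; now left |].
    eapply forces_hereditary; [apply extends_add_right | exact Hx]. }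
  assert (Hr : forall A, (forall x, In A (fst x) -> forces A x) ->
    forall x, perp (forces A) x -> closed (add_left A x)).
  { intros C HC x Hx. eapply perp_closed; [| apply HC; now left].
    eapply perp_hereditary; [apply extends_add_left | exact Hx]. }
  induction A as [P | | A [LA RA] B [LB RB] | A [LA RA] B [LB RB] | A [LA RA] B [LB RB]];
    simpl; (split; [intros x Hx | intros x Hx y Hy Hf;
                    apply (hereditary_right _ Hy) in Hx]).
  - split.
    + intros y Hy HR. apply (hereditary_left _ Hy) in Hx.
      eapply sequent_incl with (D := [Atom P]) (T := [Atom P]);
        [intros ? [<- | []]; auto .. |].
      eapply s_axiom; apply rt_refl.
    + intros _. apply perp_perp_intro; auto. apply hereditary_left.
  - apply (perp_closed (proj1 Hf)); auto.
  (* The formula already occurs in the condition: the rule acts on a second copy, and contraction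
     merges the two. The other connectives proceed likewise. *)
  - apply (closed_in_left Hx), s_bot_left, rt_refl.
  - exact Hf.
  - intros y Hy [HA HB]. apply (hereditary_left _ Hy) in Hx.
    apply (closed_in_left Hx). eapply s_imp_left; [apply rt_refl | |].
    + now apply (Hl A).
    + now apply (Hr B).
  - apply (closed_in_right Hx). eapply s_imp_right; [apply rt_refl |].
    apply (Hf (add_left A (add_right B y))).
    + eapply extends_trans; [apply extends_add_right | apply extends_add_left].
    + split; [apply LA | apply RB]; now left.
  - split; apply forces_stable; intros y Hy Hp; apply (hereditary_left _ Hy) in Hx;
      apply (closed_in_left Hx); (eapply s_and_left; [apply rt_refl |]).
    + eapply sequent_incl; [| apply incl_refl | exact (Hr A LA y Hp)].
      intros C [<- | HC]; simpl; auto.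
    + eapply sequent_incl; [| apply incl_refl | exact (Hr B LB y Hp)].
      intros C [<- | HC]; simpl; auto.
  - apply (closed_in_right Hx).
    eapply s_and_right; [apply rt_refl | now apply (Hl A) | now apply (Hl B)].
  - intros y Hy [HA HB]. apply (hereditary_left _ Hy) in Hx.
    apply (closed_in_left Hx).
    eapply s_or_left; [apply rt_refl | now apply (Hr A) | now apply (Hr B)].
  - apply (perp_closed Hf). split; intros z Hz HF;
      apply (hereditary_right _ Hz) in Hx;
      apply (closed_in_right Hx); (eapply s_or_right; [apply rt_refl |]).
    + eapply sequent_incl; [apply incl_refl | | exact (Hl A RA z HF)].
      intros C [<- | HC]; simpl; auto.
    + eapply sequent_incl; [apply incl_refl | | exact (Hl B RB z HF)].
      intros C [<- | HC]; simpl; auto.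
Qed.

Lemma step_forces : separated R -> forall s A B, step R s A B -> forall x,
  match s with
  | Minus => forces A x -> forces B x
  | Plus => forces B x -> forces A x
  end.
Proof.
  intros HR s A B H. induction H; try destruct s; simpl in *;
    try (intros x; repeat apply perp_antitone; firstorder using perp_antitone; fail).
  - intros x [_ Hx]. apply forces_stable.
    generalize (Hx (ex_intro _ _ H)). apply perp_antitone.
    (* Contraction simulates rewriting without a cut: one copy of [P] becomes [A], the other is
       weakened away. The condition enlarged by [A] forces [A] and inherits orthogonality to it, so
       it is derivable. *)
    intros y Hy z Hz HP. apply (closed_in_left HP).
    eapply s_contr_left; [apply rt_step, step_neg, H | apply rt_refl |].
    apply s_perm with (Atom P :: A :: fst z) (snd z);
      [apply perm_swap | apply Permutation_refl |].
    apply s_weak_left. apply (perp_closed (X := forces A) (x := add_left A z)).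
    + eapply perp_hereditary; [| exact Hy].
      eapply extends_trans; [exact Hz | apply extends_add_left].
    + apply forces_in. now left.
  - intros x Hx. split.
    (* The dual argument on the right; by separation, [P] has no negative rule and the second
       component below is vacuous. *)
    + intros y Hy HP. apply (closed_in_right HP).
      eapply s_contr_right; [apply rt_step, step_pos, H | apply rt_refl |].
      apply s_perm with (fst y) (Atom P :: A :: snd y);
        [apply Permutation_refl | apply perm_swap |].
      apply s_weak_right.
      apply (perp_closed (X := forces A) (x := add_right A y)).
      * apply forces_in. now left.
      * eapply forces_hereditary; [| exact Hx].
        eapply extends_trans; [exact Hy | apply extends_add_right].
    + intros [B HB]. exfalso; eauto.
Qed.

Definition valid (D T : list (form atom)) : Prop :=
  forall x, (forall A, In A D -> forces A x) ->
    (forall B, In B T -> perp (forces B) x) -> closed x.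

Lemma sequent_valid : separated R -> forall c D T, sequent R c D T -> valid D T.
Proof.
  intros HR.
  assert (Hneg : forall A B, rew R Minus A B -> forall x, forces A x -> forces B x)
    by exact (rew_monotone _ (step_forces HR) (s := Minus)).
  assert (Hpos : forall A B, rew R Plus A B -> forall x, forces B x -> forces A x)
    by exact (rew_monotone _ (step_forces HR) (s := Plus)).
  assert (Hpos' : forall A B, rew R Plus A B ->
    forall x, perp (forces A) x -> perp (forces B) x)
    by (intros A B H x; apply perp_antitone; eauto).
  assert (Hcons : forall (X : form atom -> Prop) A D, X A ->
    (forall C, In C D -> X C) -> forall C, In C (A :: D) -> X C)
    by (intros X A D HA HD C [<- | HC]; auto).
  assert (Hleft : forall A D T x, valid (A :: D) T ->
    (forall C, In C D -> forces C x) ->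
    (forall C, In C T -> perp (forces C) x) -> perp (forces A) x).
  { intros A D T x HV HD HT y Hy HA. apply HV.
    - apply Hcons; auto. intros C HC. eapply forces_hereditary; eauto.
    - intros C HC. eapply perp_hereditary; eauto. }
  (* Validity yields only a double orthogonal here; stability turns it into forcing. *)
  assert (Hright : forall A D T x, valid D (A :: T) ->
    (forall C, In C D -> forces C x) ->
    (forall C, In C T -> perp (forces C) x) -> forces A x).
  { intros A D T x HV HD HT. apply forces_stable. intros y Hy HA. apply HV.
    - intros C HC. eapply forces_hereditary; eauto.
    - apply Hcons; auto. intros C HC. eapply perp_hereditary; eauto. }
  assert (Htl : forall (X : form atom -> Prop) A D, (forall C, In C (A :: D) -> X C) ->
    X A /\ forall C, In C D -> X C)
    by (intros X A D H; split; intros; apply H; simpl; auto).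
  induction 1 as
    [D D' T T' HD' HT' _ IH | A B C HA HB | D T A B C _ HA HB _ IHA _ IHB
    | D T A B1 B2 H1 H2 _ IH | D T A B1 B2 H1 H2 _ IH
    | D T A _ IH | D T A _ IH
    | D T A B C H _ IHA _ IHB | D T A B C H _ IH
    | D T A B C H _ IH | D T A B C H _ IHA _ IHB
    | D T A B C H _ IHA _ IHB | D T A B C H _ IH | D T A H]; intros x HD HT.
  - apply IH; intros C HC; [apply HD | apply HT]; eapply Permutation_in; eauto.
  - apply (perp_closed (HT B (or_introl eq_refl))).
    apply (Hpos _ _ HB), (Hneg _ _ HA), HD. now left.
  (* Cut: the condition is orthogonal to [A] by the first premise and forces [B] by the second,
     hence forces [C] and then [A]. *)
  - eapply perp_closed; [eapply Hleft; eauto |].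
    apply (Hneg _ _ HA), (Hpos _ _ HB). eapply Hright; eauto.
  - apply Htl in HD as [HC HD]. apply IH; auto.
    apply Hcons; [eauto |]. apply Hcons; eauto.
  - apply Htl in HT as [HC HT]. apply IH; auto.
    apply (Hcons (fun A => perp (forces A) x)); [eauto |].
    apply (Hcons (fun A => perp (forces A) x)); eauto.
  - apply Htl in HD as [_ HD]. auto.
  - apply (Htl (fun A => perp (forces A) x)) in HT as [_ HT]. auto.
  - apply Htl in HD as [HC HD]. apply (Hneg _ _ H) in HC.
    apply (perp_closed HC). split; [eapply Hright | eapply Hleft]; eauto.
  - apply Htl in HT as [HC HT]. apply (Hpos' _ _ H) in HC.
    apply (perp_closed HC). intros y Hy [HA HB]. apply IH.
    + apply Hcons; auto. intros E HE. eapply forces_hereditary; eauto.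
    + apply (Hcons (fun A => perp (forces A) y)); auto.
      intros E HE. eapply perp_hereditary; eauto.
  - apply Htl in HD as [HC HD]. apply (Hneg _ _ H) in HC as [HA HB].
    apply IH; auto. apply Hcons; [exact HA |]. now apply Hcons.
  - apply Htl in HT as [HC HT]. apply (Hpos' _ _ H) in HC.
    apply (perp_closed HC). split; eapply Hright; eauto.
  - apply Htl in HD as [HC HD]. apply (Hneg _ _ H) in HC.
    apply (perp_closed HC). split; eapply Hleft; eauto.
  - apply Htl in HT as [HC HT]. apply (Hpos' _ _ H) in HC.
    eapply perp_closed; [exact HC |]. intros y Hy [HA HB]. apply IH.
    + intros E HE. eapply forces_hereditary; eauto.
    + apply (Hcons (fun A => perp (forces A) y)); auto.
      apply (Hcons (fun A => perp (forces A) y)); auto.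
      intros E HE. eapply perp_hereditary; eauto.
  - apply (Hneg _ _ H), HD. now left.
Qed.

(** The sequent is itself a condition, and by [forces_in] it forces its left formulas and is
    orthogonal to its right ones. *)
Lemma valid_cut_free D T : valid D T -> sequent R CutFree D T.
Proof.
  intros HV. apply (HV (D, T)); intros A HA; now apply forces_in.
Qed.

End Forcing.

(** * The rewrite system of a consistent theory *)

Theorem theorem2 (atom : Type) (Gamma : theory atom) (HGamma : consistent Gamma) :
  exists R : rewrite_system atom,
    presents R Gamma /\ commuting R /\ cut_elimination R.
Proof.
  destruct (consistent_model HGamma) as [v Hv].
  set (R := {| neg_rule := fun P A => Gamma A /\ ~ v P;
               pos_rule := fun P A => (exists B, Gamma B /\ A = Neg B) /\ v P |}).
  assert (HR : separated R) by (intros P A B [_ H] [_ H']; auto).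
  exists R. split; [| split].
  (* By soundness and completeness, comparing models suffices. *)
  - assert (Hmod : forall w, models w (theory_of R) <-> models w Gamma).
    { intros w; split; intros Hw.
      - intros A HA. destruct (classic (exists P, ~ (w P <-> v P))) as [[P HP] | Hwv].
        + apply NNPP. intros HnA. apply HP.
          destruct (classic (v P)) as [HvP | HvP].
          * assert (HP' : eval w (Imp (Neg A) (Atom P)))
              by (apply Hw, theory_of_pos; split; eauto).
            split; [auto | intros _; exact (HP' HnA)].
          * assert (HP' : eval w (Imp (Atom P) A))
              by (apply Hw, theory_of_neg; split; auto).
            split; [intros HwP; destruct (HnA (HP' HwP)) | tauto].
        + assert (Heq : forall B, eval w B <-> eval v B).
          { assert (Hat : forall P, w P <-> v P)
              by (intros P; apply NNPP; intros HP; apply Hwv; eauto).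
            induction B; simpl; firstorder. }
          apply Heq, Hv, HA.
      - intros A HA. destruct HA as [P A [HA _] | P A [(B & HB & ->) _]]; simpl.
        + intros _. now apply Hw.
        + intros HnB. destruct (HnB (Hw B HB)). }
    intros A; split; intros HA; apply derives_complete; intros w Hw;
      apply (derives_sound HA), Hmod, Hw.
  - now apply commuting_separated.
  - split; [now apply proves_strongly_normalizable |].
    intros D T H. apply valid_cut_free. eapply sequent_valid; eauto.
Qed.
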